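(* Let $X\ne\{0\}$ be a uniformly convex complex Banach space and let $T\in\mathcal B(X)$ be a contraction ($\|T\|\le1$). The following assertions are equivalent: (i) $\sup_{n\ge1}\|I-T^n\|<2$; (ii) $T^N$ is a Ritt operator for some odd positive integer $N$; (iii) $T$ is a $\mathrm{Ritt}_E$ operator for some finite nonempty set $E\subset\mathbb T$ of roots of unity of odd order. Moreover, the following quantitative version of (ii)$\Rightarrow$(i) holds: if $T^N$ is a Ritt operator with $N$ an odd positive integer, then $$\sup_{n\ge1}\|I-T^n\|\le 2\Big(1-\delta_X\Big(\frac1{NK_+}\Big)\Big),\qquad K_+:=\sup_{n\ge1}\|(I+T^{nN})^{-1}\|<\infty .$$
   Context: $\mathbb D$ is the open unit disc, $\mathbb T$ the unit circle. A bounded operator $T$ on a complex Banach space is a Ritt operator if $\sigma(T)\subset\overline{\mathbb D}$ and $\sup_{|\lambda|>1}|\lambda-1|\,\|(\lambda-T)^{-1}\|<\infty$. For a finite nonempty $E\subset\mathbb T$, $T$ is a $\mathrm{Ritt}_E$ operator if $\sigma(T)\subset\overline{\mathbb D}$ and $\sup_{|\lambda|>1}\operatorname{dist}(\lambda,E)\,\|(\lambda-T)^{-1}\|<\infty$. The modulus of convexity of $X$ is $$\delta_X(\varepsilon):=\inf\Big\{1-\Big\|\frac{x+y}2\Big\|:\ \|x\|\le1,\ \|y\|\le1,\ \|x-y\|\ge\varepsilon\Big\},\qquad 0<\varepsilon\le2;$$ $X$ is uniformly convex if $\delta_X(\varepsilon)>0$ for all $\varepsilon\in(0,2]$. *)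

(* Defs.v *)
From mathcomp Require Export all_boot all_order all_algebra.
From mathcomp Require Export complex.
From mathcomp Require Export boolp classical_sets functions cardinality reals.
From mathcomp Require Export ereal topology normedtype.

Export Order.TTheory GRing.Theory Num.Theory.
Export numFieldNormedType.Exports.

#[export] Set Implicit Arguments.
#[export] Unset Strict Implicit.
#[export] Unset Printing Implicit Defensive.

Local Open Scope classical_set_scope.
Local Open Scope ring_scope.

(* The complex field is R[i] for R : realType, and a complex Banach space is a
   completeNormedModType R[i].  In a normed space over R[i] the norm `|x| has values in R[i]
   (where it is real and nonnegative); rnorm x is the same number in R.
   It also applies to scalars, since R[i] is normed over itself. *)
Definition rnorm (R : realType) (V : normedZmodType R[i]) (x : V) : R :=
  complex.Re `|x|.

Section Operators.
Context {R : realType} {X : completeNormedModType R[i]}.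
Implicit Types (A B T : X -> X) (l : R[i]) (E : set R[i]).

(* For linear maps, continuity is boundedness: linear_bounded_continuous. *)
Definition bounded_operator A : Prop := linear A /\ continuous A.

(* Operator norm; extended-real valued, so that suprema of norms make sense
   without a boundedness proviso. *)
Definition opnorm A : \bar R :=
  ereal_sup [set (rnorm (A x))%:E | x in [set x : X | rnorm x <= 1]].

Definition is_opinv A B : Prop :=
  [/\ bounded_operator B, cancel A B & cancel B A].

Definition invertible_op A : Prop := exists B, is_opinv A B.

(* The inverse in B(X) of an invertible operator (the zero map if A is not
   invertible; used only where invertibility is asserted). *)
Definition opinv A : X -> X := xget (fun=> 0) [set B | is_opinv A B].

Definition spectrum T : set R[i] :=
  [set l | ~ invertible_op (fun x => l *: x - T x)].

Definition resolvent T l : X -> X := opinv (fun x => l *: x - T x).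

Definition is_Ritt T : Prop :=
  [/\ bounded_operator T,
      spectrum T `<=` [set l | rnorm l <= 1] &
      (ereal_sup [set (rnorm (l - 1))%:E * opnorm (resolvent T l)
                 | l in [set l | 1 < rnorm l]%R] < +oo)%E].

Definition dist_to l E : R := inf [set rnorm (l - z) | z in E].

Definition unit_circle : set R[i] := [set z | rnorm z = 1].

Definition is_Ritt_on E T : Prop :=
  [/\ bounded_operator T,
      spectrum T `<=` [set l | rnorm l <= 1] &
      (ereal_sup [set (dist_to l E)%:E * opnorm (resolvent T l)
                 | l in [set l | 1 < rnorm l]%R] < +oo)%E].

Definition sup_I_sub_pow T : \bar R :=
  ereal_sup [set opnorm (fun x => x - iter n T x) | n in [set n | (1 <= n)%N]].

Definition Kplus T (N : nat) : \bar R :=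
  ereal_sup [set opnorm (opinv (fun x => x + iter (n * N) T x))
            | n in [set n | (1 <= n)%N]].

End Operators.

(* Meaningful for 0 < e <= 2 and X != {0}: the set below is then nonempty,
   and 0 is a lower bound of it. *)
Definition convexity_modulus (R : realType) (X : completeNormedModType R[i])
    (e : R) : R :=
  inf [set r : R | exists x y : X,
    [/\ rnorm x <= 1, rnorm y <= 1, e <= rnorm (x - y) &
        r = 1 - rnorm (2^-1 *: (x + y))]].

Definition uniformly_convex (R : realType) (X : completeNormedModType R[i]) :
    Prop :=
  forall e : R, 0 < e -> e <= 2 -> 0 < convexity_modulus X e.

(* Main.v *)
From HB Require Import structures.
Require Import Defs.
From mathcomp Require Import cyclic separable cyclotomic sequences.
From mathcomp Require Import ring lra zify.
Local Open Scope classical_set_scope.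
Local Open Scope ring_scope.

(** Every assertion is turned into a lower bound for l - T, where l is a complex
    number.  A contraction T of a Banach space has l - T invertible for |l| > 1,
    so being Ritt, or Ritt relative to E, only means that
    |(l - T) x| >= c d(l) |x| for |l| > 1, with d(l) = |l - 1|, or d(l) the
    distance from l to E.  As d is Lipschitz, the same bound on the circle
    |l| = 1 is equivalent ([exterior_of_circle], [circle_of_exterior]).  The
    hub of the proof is the property [unity_below T N], with N odd:
    |(l - T) x| >= c |l^N - 1| |x| on the circle.

    Bounded to [unity_below].  If |I - T^n| <= 2 - e for all n, then
    |(I + T^n) x| >= e |x|.  As l^n - T^n = (l - T) (sum of n contractions), a
    power l^n within e/2 of -1 gives |(l - T) x| >= e/(2n) |x|.  By
    Dirichlet's theorem some power w = l^m with m <= Q is close to 1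
    ([exists_expr_near1]); unless w = 1, a power of w whose exponent is at most
    12 / |w - 1| is close to -1 ([exists_expr_near_opp1]).  Hence
    |(l - T) x| >= c |l^m - 1| |x|, and |l^m - 1| >= |l^(Q!) - 1| / Q!.  The
    factors of 2 of the exponent Q! are then removed one at a time:
    l^(2M) - 1 = (l^M - 1) (l^M + 1), and where l^M + 1 is small the bound is
    already there ([odd_unity_below]).

    [unity_below] and the two Ritt conditions.  The partial fraction
    decomposition
      n l^n (l^n - T^n)^-1 = sum of w (w - T)^-1 over the w with w^n = l^n
    ([sum_divdiff_roots]) turns a lower bound common to all w - T into one for
    l^n - T^n.  This shows that T^N is Ritt and, for the operator of
    multiplication by a scalar, that the distance from l to the N-th roots of
    unity is at most |l^N - 1|, so that T is Ritt relative to these.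
    Conversely, if z^N = 1 for all z in E, then |l^N - 1| <= N d(l, E).

    Ritt to bounded, quantitatively.  Let S = T^N be Ritt.  The decomposition
    of (I + S^n)^-1 over the roots w of w^n = -1 is compared with that of
    (I + S^n / t^n)^-1, t = 1 + 1/n, which is bounded by 2.  By the resolvent
    identity the difference is at most a constant times
    n^-2 sum 1/|w - 1|^2 = 1/4, so (I + S^n)^-1 is bounded uniformly in n
    ([rnorm_I_add_pow_ge]).  Since N is odd, I + T^n divides I + T^(nN), with
    a quotient of norm at most N, so |x + T^n x| >= |x| / (N K+).  Uniform
    convexity applied to x and - T^n x bounds |x - T^n x|. *)

(** * Real-valued norms *)

Section Norm.
Context {R : realType}.

Section Vector.
Context {V : normedZmodType R[i]}.
Implicit Types (x y : V).

Lemma norm_rnorm x : `|x| = (rnorm x)%:C%C.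
Proof. by rewrite /rnorm RRe_real ?normr_real. Qed.

Lemma rnorm_ge0 x : 0 <= rnorm x.
Proof. by rewrite -ler0c -norm_rnorm normr_ge0. Qed.

Lemma rnorm0 : rnorm (0 : V) = 0.
Proof. by rewrite /rnorm normr0. Qed.

Lemma rnorm0_eq0 x : rnorm x = 0 -> x = 0.
Proof. by move=> x0; apply/eqP; rewrite -normr_eq0 norm_rnorm x0. Qed.

Lemma rnorm_gt0 x : x != 0 -> 0 < rnorm x.
Proof.
move=> x0; rewrite lt_neqAle rnorm_ge0 andbT eq_sym.
by apply: contra x0 => /eqP /rnorm0_eq0 ->.
Qed.

Lemma rnormN x : rnorm (- x) = rnorm x.
Proof. by rewrite /rnorm normrN. Qed.

Lemma rnormBC x y : rnorm (x - y) = rnorm (y - x).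
Proof. by rewrite /rnorm distrC. Qed.

Lemma ler_rnormD x y : rnorm (x + y) <= rnorm x + rnorm y.
Proof. by rewrite -lecR rmorphD /= -!norm_rnorm ler_normD. Qed.

Lemma ler_rnormB x y : rnorm (x - y) <= rnorm x + rnorm y.
Proof. by rewrite -(rnormN y) ler_rnormD. Qed.

Lemma lerB_rnorm x y : rnorm x - rnorm y <= rnorm (x - y).
Proof. by rewrite lerBlDr -{1}(subrK y x) ler_rnormD. Qed.

Lemma lerB_rnormD x y : rnorm x - rnorm y <= rnorm (x + y).
Proof. by rewrite -{2}(opprK y) -(rnormN y) lerB_rnorm. Qed.

Lemma ler_rnorm_sum (I : Type) (s : seq I) (P : pred I) (F : I -> V) :
  rnorm (\sum_(i <- s | P i) F i) <= \sum_(i <- s | P i) rnorm (F i).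
Proof.
elim/big_rec2: _ => [|i y1 y2 _ le_y]; first by rewrite rnorm0.
by apply: le_trans (ler_rnormD _ _) _; rewrite lerD2l.
Qed.

End Vector.

Lemma rnormZ (V : normedModType R[i]) (l : R[i]) (x : V) :
  rnorm (l *: x) = rnorm l * rnorm x.
Proof.
by apply: (@complexI R); rewrite rmorphM /= -!norm_rnorm normrZ.
Qed.

Lemma rnormZr (V : normedModType R[i]) (a : R) (x : V) :
  0 <= a -> rnorm (a%:C%C *: x) = a * rnorm x.
Proof.
move=> a0; rewrite rnormZ; congr (_ * _).
by rewrite /rnorm ger0_norm //= ler0c.
Qed.

Implicit Types (z w : R[i]).

Lemma rnormM z w : rnorm (z * w) = rnorm z * rnorm w.
Proof. exact: (@rnormZ (R[i]^o) z w). Qed.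

Lemma rnorm1 : rnorm (1 : R[i]) = 1.
Proof. by rewrite /rnorm normr1. Qed.

Lemma rnormX z n : rnorm (z ^+ n) = rnorm z ^+ n.
Proof. by elim: n => [|n IH]; rewrite ?rnorm1 // !exprS rnormM IH. Qed.

Lemma rnorm_real (a : R) : rnorm (a%:C%C : R[i]) = `|a|.
Proof. by rewrite /rnorm normc_def /= expr0n addr0 sqrtr_sqr. Qed.

Lemma rnorm_nat n : rnorm (n%:R : R[i]) = n%:R.
Proof. by rewrite /rnorm normr_nat -(rmorph_nat (real_complex R)). Qed.

Lemma rnorm_sqr z : rnorm z ^+ 2 = complex.Re z ^+ 2 + complex.Im z ^+ 2.
Proof.
apply: (@complexI R); rewrite add_Re2_Im2 norm_rnorm.
by rewrite rmorphXn.
Qed.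

Lemma rnorm_expr_eq1 z n : (0 < n)%N -> rnorm (z ^+ n) = 1 -> rnorm z = 1.
Proof.
move=> n0; rewrite rnormX => /eqP.
by rewrite pexpr_eq1 ?rnorm_ge0 // => /eqP.
Qed.

End Norm.

(** * Partial fractions over the roots of a complex number *)

Section Roots.
Context {R : realType}.
Implicit Types (z w : R[i]).

Lemma exists_prim_root n : (0 < n)%N -> exists z, n.-primitive_root z.
Proof.
pose p : {poly R[i]} := 'X^n - 1; have [r Dp] := closed_field_poly_normal p.
move=> n_gt0; rewrite (monicP _) ?monicXnsubC // scale1r in Dp.
have rn1: all n.-unity_root r by apply/allP=> z; rewrite -root_prod_XsubC -Dp.
have sz_r: (n < (size r).+1)%N.
  by rewrite -(size_prod_XsubC r id) -Dp size_XnsubC.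
have [|z] := hasP (has_prim_root n_gt0 rn1 _ sz_r); last by exists z.
by rewrite -separable_prod_XsubC -Dp separable_Xn_sub_1 // pnatr_eq0 -lt0n.
Qed.

Lemma sum_expr_root_of_unity n z : z ^+ n = 1 -> z != 1 ->
  \sum_(i < n) z ^+ i = 0.
Proof.
move=> zn1 z1; apply: (@mulfI _ (z - 1)); first by rewrite subr_eq0.
by rewrite -subrX1 zn1 subrr mulr0.
Qed.

Lemma sum_expr_prim_root n k z : n.-primitive_root z ->
  \sum_(i < n) z ^+ i ^+ k = if (n %| k)%N then n%:R else 0.
Proof.
move=> zP; under eq_bigr do rewrite exprAC.
rewrite (prim_order_dvd zP); case: eqVneq => [->|zk1].
  by under eq_bigr do rewrite expr1n; rewrite sumr_const card_ord.
by rewrite sum_expr_root_of_unity // exprAC (prim_expr_order zP) expr1n.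
Qed.

End Roots.

Section DividedDifference.
Context {R : realType} {V : normedModType R[i]}.
Implicit Types (l z : R[i]) (x : V).

(** The divided difference (l^n - T^n) / (l - T). *)
Definition divdiff (T : V -> V) l n x : V :=
  \sum_(k < n) l ^+ (n - k.+1) *: iter k T x.

Lemma iter_is_linear (T : {linear V -> V}) n : linear (iter n T).
Proof. by move=> a x y; elim: n => //= n ->; rewrite linearP. Qed.

HB.instance Definition _ (T : {linear V -> V}) n :=
  GRing.isLinear.Build R[i] V V _ (iter n T) (iter_is_linear T n).

Lemma divdiffP (T : {linear V -> V}) l n x :
  l *: divdiff T l n x - T (divdiff T l n x) = l ^+ n *: x - iter n T x.
Proof.
rewrite /divdiff; elim: n => [|n IH].
  by rewrite !big_ord0 scaler0 linear0 expr0 scale1r /= !subrr.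
rewrite big_ord_recr /= subnn expr0 scale1r.
under eq_bigr => k _ do
  rewrite subSS -[(n - k)%N]subSS subSn ?ltn_ord // exprS -scalerA.
rewrite -scaler_sumr [T (_ + _)]linearP scalerDr /=.
move: IH; set g := \sum_(_ < _) _ => IH.
by rewrite opprD addrACA -scalerBr IH scalerBr scalerA -exprS addrA subrK.
Qed.

(** The partial fraction decomposition of (l^n - T^n)^-1, with denominators
    cleared: l * z ^+ i runs through the n-th roots of l^n, and averaging over
    them kills all powers of T but the 0-th. *)
Lemma sum_divdiff_roots (T : {linear V -> V}) n z l x :
  n.-primitive_root z ->
  \sum_(i < n) (l * z ^+ i) *: divdiff T (l * z ^+ i) n x =
  (n%:R * l ^+ n) *: x.
Proof.
move=> zP; rewrite /divdiff.
under eq_bigr => i _.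
  rewrite scaler_sumr.
  under eq_bigr => k _.
    rewrite scalerA -exprS -subSn ?ltn_ord // subSS exprMn.
    over.
  over.
rewrite exchange_big /=; under eq_bigr => k _.
  rewrite -scaler_suml -mulr_sumr sum_expr_prim_root //.
  over.
have := prim_order_gt0 zP; case: n zP => // n zP _.
rewrite big_ord_recl /= subn0 dvdnn big1 ?addr0 1?mulrC // => k _.
rewrite gtnNdvd ?mulr0 ?scale0r //= /bump /= add1n subSS.
  by rewrite subn_gt0.
by rewrite ltnS leq_subr.
Qed.

Definition contraction (T : V -> V) := forall x, rnorm (T x) <= rnorm x.

Lemma contraction_iter (T : V -> V) n : contraction T -> contraction (iter n T).
Proof. by move=> Tc x; elim: n => //= n; apply: le_trans (Tc _). Qed.

(** Dividing l^n - T^n by l - T leaves a sum of n contractions. *)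
Lemma rnorm_pow_sub (T : {linear V -> V}) l n x :
  contraction T -> rnorm l = 1 ->
  rnorm (l ^+ n *: x - iter n T x) <= n%:R * rnorm (l *: x - T x).
Proof.
move=> Tc l1; elim: n x => [|n IH] x.
  by rewrite expr0 scale1r subrr rnorm0 mul0r.
have -> : l ^+ n.+1 *: x - iter n.+1 T x =
    l ^+ n *: (l *: x - T x) + (l ^+ n *: T x - iter n T (T x)).
  by rewrite -iterSr scalerBr scalerA -exprSr addrA subrK.
apply: le_trans (ler_rnormD _ _) _.
rewrite rnormZ rnormX l1 expr1n mul1r -natr1 mulrDl mul1r addrC lerD2r.
apply: le_trans (IH _) _; rewrite ler_wpM2l //.
by rewrite -linearZ -linearB; apply: Tc.
Qed.

(** Partial fractions: the resolvent of T^n at l^n is an average of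
    resolvents of T at the n-th roots of l^n, so it inherits a bound common
    to all of these. *)
Lemma below_pow (T : {linear V -> V}) n z l (a : R) x :
  n.-primitive_root z -> rnorm l = 1 -> 0 <= a ->
  (forall i x, a * rnorm x <= rnorm ((l * z ^+ i) *: x - T x)) ->
  a * rnorm x <= rnorm (l ^+ n *: x - iter n T x).
Proof.
move=> zP l1 a0 aP; have n0 := prim_order_gt0 zP.
have z1 : rnorm z = 1.
  by apply: (@rnorm_expr_eq1 _ _ n) => //; rewrite (prim_expr_order zP) rnorm1.
have n0r : 0 < n%:R :> R by rewrite ltr0n.
rewrite -(ler_pM2l n0r) mulrCA.
have <- : rnorm ((n%:R * l ^+ n) *: x) = n%:R * rnorm x.
  by rewrite rnormZ rnormM rnorm_nat rnormX l1 expr1n mulr1.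
rewrite -(sum_divdiff_roots T l x zP).
apply: le_trans (_ : a * \sum_(i < n) rnorm (divdiff T (l * z ^+ i) n x) <= _).
  rewrite ler_wpM2l //; apply: le_trans (ler_rnorm_sum _ _ _) _.
  apply: ler_sum => i _; rewrite rnormZ rnormM l1 rnormX z1 expr1n.
  by rewrite !mul1r.
rewrite mulr_sumr mulr_natl -[X in _ *+ X]card_ord -sumr_const.
apply: ler_sum => i _; apply: le_trans (aP i _) _.
by rewrite divdiffP exprMn exprAC (prim_expr_order zP) expr1n mulr1.
Qed.

End DividedDifference.

(** * Powers of unimodular numbers *)

Section Circle.
Context {R : realType}.
Implicit Types (z w l : R[i]).

Lemma ReD z w : complex.Re (z + w) = complex.Re z + complex.Re w.
Proof. by case: z w => [a b] [c d]. Qed.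

Lemma ler_Re_rnorm z : `|complex.Re z| <= rnorm z.
Proof.
rewrite -(@ler_pXn2r _ 2) ?nnegrE ?rnorm_ge0 //.
by rewrite real_normK ?num_real // rnorm_sqr lerDl sqr_ge0.
Qed.

Lemma conj_unimodular w : rnorm w = 1 -> (w ^*)%R = w^-1.
Proof.
move=> w1; have ww : w * (w ^*)%R = 1 by rewrite -normCK norm_rnorm w1 expr1n.
have w0 : w != 0 by apply: contra_eq_neq ww => ->; rewrite mul0r eq_sym oner_neq0.
by apply: (mulfI w0); rewrite ww divff.
Qed.

Lemma sqr_rnormC z : ((rnorm z) ^+ 2)%:C%C = z * (z ^*)%R.
Proof. by rewrite -normCK norm_rnorm rmorphXn. Qed.

(** Parseval for the vector (1, ..., 1): the vectors (1, u, ..., u^(n-1)) with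
    u^n = -1 are orthogonal to each other, and the coordinates of such a vector
    sum to -2 / (u - 1). *)
Lemma sum_inv_sqr_dist_roots n z w : n.-primitive_root z -> w ^+ n = -1 ->
  \sum_(i < n) (rnorm (w * z ^+ i - 1) ^+ 2)^-1 = n%:R ^+ 2 / 4 :> R.
Proof.
move=> zP wn; have n0 := prim_order_gt0 zP.
pose u (i : 'I_n) := w * z ^+ i.
have un i : u i ^+ n = -1.
  by rewrite exprMn wn [_ ^+ i ^+ n]exprAC (prim_expr_order zP) expr1n mulr1.
have u1 i : rnorm (u i) = 1.
  by apply: (@rnorm_expr_eq1 _ _ n); rewrite // un rnormN rnorm1.
have u0 i : u i != 0.
  by apply: contra_eq_neq (u1 i) => ->; rewrite rnorm0 eq_sym oner_neq0.
pose P i := \sum_(j < n) u i ^+ j.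
have uP i : rnorm (u i - 1) * rnorm (P i) = 2.
  by rewrite -rnormM -subrX1 un -opprD rnormN (rnorm_nat 2).
have -> : \sum_(i < n) (rnorm (w * z ^+ i - 1) ^+ 2)^-1 =
    (\sum_(i < n) rnorm (P i) ^+ 2) / 4.
  rewrite mulr_suml; apply: eq_bigr => i _.
  have P0 : rnorm (P i) != 0.
    by apply: contra_eq_neq (uP i) => ->; rewrite mulr0 eq_sym pnatr_eq0.
  have -> : rnorm (w * z ^+ i - 1) = 2 / rnorm (P i) by rewrite -(uP i) mulfK.
  by rewrite exprMn exprVn invfM invrK mulrC; congr (_ * _^-1); ring.
congr (_ / _); apply: (@complexI R); rewrite rmorph_sum rmorphXn rmorph_nat /=.
under eq_bigr => i _.
  rewrite sqr_rnormC rmorph_sum mulr_suml.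
  under eq_bigr => j _.
    rewrite mulr_sumr.
    under eq_bigr => k _.
      have -> : u i ^+ j * (u i ^+ k)^* =
          - (w ^+ (j + (n - k))) * z ^+ i ^+ (j + (n - k)).
        rewrite rmorphXn /= conj_unimodular // exprVn mulNr -exprMn -/(u i).
        rewrite exprD -mulrN; congr (_ * _).
        apply: (@mulfI _ (u i ^+ k)); first exact: expf_neq0.
        by rewrite divff ?expf_neq0 // mulrN -exprD subnKC ?un ?opprK // ltnW.
      over.
    over.
  over.
rewrite exchange_big /=.
have -> : (n%:R ^+ 2 : R[i]) = \sum_(j < n) n%:R.
  by rewrite sumr_const card_ord expr2 mulr_natr.
apply: eq_bigr => j _; rewrite exchange_big (bigD1 j) //= [X in _ + X]big1.
  rewrite -mulr_sumr sum_expr_prim_root // subnKC ?dvdnn ?wn; last exact: ltnW.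
  by rewrite opprK mul1r addr0.
move=> k kj; rewrite -mulr_sumr sum_expr_prim_root //.
case: ifPn; rewrite ?mulr0 // => /dvdnP[q]; have := ltn_ord j; have := ltn_ord k.
have : (k != j :> nat) by [].
case: q => [|[|q]]; rewrite ?mulSn; lia.
Qed.

(** As long as the first k powers have real part at least 1/2, their sum, a
    geometric one, forces k |w - 1| <= 4.  The first power v with smaller
    real part is within |w - 1| of the line Re = 1/2, that is close to a
    primitive sixth root of unity, and its cube is close to -1. *)
Lemma exists_expr_near_opp1 w : rnorm w = 1 -> w != 1 ->
  exists k, [/\ (0 < k)%N, k%:R * rnorm (w - 1) <= 4 &
    rnorm (w ^+ (k * 3) + 1) <= 4 * rnorm (w - 1)].
Proof.
move=> w1 wn1; set s := rnorm (w - 1).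
have s0 : 0 < s by rewrite rnorm_gt0 // subr_eq0.
have long k : (forall j, (j < k)%N -> 1 / 2 <= complex.Re (w ^+ j)) ->
    k%:R * s <= 4.
  move=> kP; have : k%:R / 2 <= complex.Re (\sum_(j < k) w ^+ j).
    elim: k kP => [|k IH] kP; first by rewrite big_ord0 mul0r.
    rewrite big_ord_recr /= ReD -natr1 mulrDl lerD ?kP //.
    by apply: IH => j jk; apply: kP; apply: leqW.
  set S := \sum_(_ < _) _ => kS.
  have sS : s * rnorm S <= 2.
    rewrite -rnormM -subrX1; apply: le_trans (ler_rnormB _ _) _.
    by rewrite rnormX w1 expr1n rnorm1.
  have ReS : complex.Re S <= rnorm S.
    exact: le_trans (ler_norm _) (ler_Re_rnorm _).
  nra.
have exk : exists k, complex.Re (w ^+ k) < 1 / 2.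
  apply: contrapT => /forallNP noex.
  have : (Num.truncn (4 / s)).+1%:R * s <= 4.
    by apply: long => j _; rewrite leNgt; apply/negP/noex.
  by apply/negP; rewrite -ltNge -ltr_pdivrMr // truncnS_gt.
case: (ex_minnP exk) => k kP kmin.
have kge j : (j < k)%N -> 1 / 2 <= complex.Re (w ^+ j).
  by move=> jk; rewrite leNgt; apply/negP => /kmin; rewrite leqNgt jk.
have k0 : (0 < k)%N.
  by rewrite lt0n; apply/eqP => k0; move: kP; rewrite k0 expr0 /=; lra.
exists k; split => //; first exact: long.
have vs : 1 / 2 - s <= complex.Re (w ^+ k).
  have kk : (k.-1 < k)%N by rewrite prednK.
  have := kge _ kk; rewrite -{2}(prednK k0) exprSr.
  have -> : w ^+ k.-1 * w = w ^+ k.-1 + w ^+ k.-1 * (w - 1) by ring.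
  have : `|complex.Re (w ^+ k.-1 * (w - 1))| <= s.
    by apply: le_trans (ler_Re_rnorm _) _; rewrite rnormM rnormX w1 expr1n mul1r.
  by rewrite ReD ler_norml => /andP[]; lra.
rewrite exprM; set v := w ^+ k in kP vs *.
have v1 : rnorm v = 1 by rewrite rnormX w1 expr1n.
have -> : v ^+ 3 + 1 = (v + 1) * (v * (2 * complex.Re v - 1)%:C%C).
  (* v ^+ 2 - v + 1 = v (v + v^-1 - 1), and v + v^-1 = 2 Re v *)
  have -> : v ^+ 3 + 1 = (v + 1) * (v ^+ 2 - v + 1) by ring.
  congr (_ * _); have := rnorm_sqr v; rewrite v1 expr1n.
  case: v {kP vs v1} => a b /= ab; rewrite expr2.
  apply/eqP; rewrite eq_complex /=; apply/andP; split; apply/eqP; nra.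
rewrite !rnormM v1 mul1r rnorm_real ltr0_norm; last lra.
have := ler_rnormD v 1; rewrite v1 rnorm1 => ?.
have := rnorm_ge0 (v + 1); nra.
Qed.

Lemma rnorm_unimodular_Re z w : rnorm z = 1 -> rnorm w = 1 ->
  rnorm (z - w) * rnorm (z * w - 1) = 2 * `|complex.Re z - complex.Re w|.
Proof.
move=> z1 w1; apply/eqP; rewrite -(@eqrXn2 _ 2) ?mulr_ge0 ?rnorm_ge0 //.
rewrite !exprMn real_normK ?num_real // !rnorm_sqr.
move: (rnorm_sqr z) (rnorm_sqr w); rewrite z1 w1 expr1n.
case: z w {z1 w1} => [a b] [c d] /= ab cd; apply/eqP.
have -> : (a - c) ^+ 2 + (b - d) ^+ 2 = 2 - 2 * (a * c + b * d).
  transitivity ((a ^+ 2 + b ^+ 2) + (c ^+ 2 + d ^+ 2) - 2 * (a * c + b * d)).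
    by ring.
  by rewrite -ab -cd; ring.
have -> : (a * c - b * d - 1) ^+ 2 + (a * d + b * c - 0) ^+ 2 =
    2 - 2 * (a * c - b * d).
  transitivity ((a ^+ 2 + b ^+ 2) * (c ^+ 2 + d ^+ 2) + 1
    - 2 * (a * c - b * d)); first by ring.
  by rewrite -ab -cd; ring.
have bd : (b * d) ^+ 2 = (1 - a ^+ 2) * (1 - c ^+ 2).
  rewrite exprMn; congr (_ * _); lra.
transitivity (4 * ((1 - a * c) ^+ 2 - (b * d) ^+ 2)); first by ring.
by rewrite bd; ring.
Qed.

(** Pigeonhole principle on the real parts of the powers of l: since
    |u - v| |u v - 1| = 2 |Re u - Re v| on the circle, powers l^i and l^j with
    close real parts make l^(j-i) or l^(i+j) close to 1. *)
Lemma exists_expr_near1 (e : R) : 0 < e -> exists Q, (0 < Q)%N /\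
  forall l, rnorm l = 1 ->
    exists m, [/\ (0 < m)%N, (m <= Q)%N & rnorm (l ^+ m - 1) <= e].
Proof.
move=> e0; pose M := (Num.truncn (4 / e ^+ 2)).+1.
have e20 : 0 < e ^+ 2 by rewrite exprn_gt0.
have M0 : 0 < M%:R :> R by rewrite ltr0n.
have Me : 4 / M%:R <= e ^+ 2.
  by rewrite ler_pdivrMr // mulrC -ler_pdivrMr // ltW // truncnS_gt.
exists (M.+2 + M.+2)%N; split => // l l1.
have lX k : rnorm (l ^+ k) = 1 by rewrite rnormX l1 expr1n.
(* [-1, 1] is cut into intervals of length 2 / M; the right endpoint 1 gets a
   class of its own, whence M.+1 classes for M.+2 powers *)
pose r i := (complex.Re (l ^+ i) + 1) * (M%:R / 2).
have r0 i : 0 <= r i.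
  rewrite mulr_ge0 ?divr_ge0 //.
  by have := ler_Re_rnorm (l ^+ i); rewrite lX ler_norml => /andP[]; lra.
have rM i : (Num.truncn (r i) < M.+1)%N.
  have : r i <= M%:R.
    have := ler_Re_rnorm (l ^+ i); rewrite lX ler_norml => /andP[_ ?].
    rewrite /r; nra.
  move=> riM; rewrite ltnS -(ler_nat R).
  by apply: le_trans riM; rewrite truncn_le.
pose f (i : 'I_M.+2) : 'I_M.+1 := Ordinal (rM i.+1).
have [i [j [ij fij]]] : exists i j, i != j /\ f i = f j.
  apply: contrapT => noex.
  suff /leq_card : injective f by rewrite !card_ord ltnn.
  move=> i j fij; apply/eqP/negP => /negP ij; apply: noex; exists i, j.
  by split.
wlog lt_ij : i j ij fij / (i < j)%N.
  move=> IH; case: (ltngtP i j) => [lt|lt|/val_inj eq].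
  - exact: IH lt.
  - by apply: IH lt => //; rewrite eq_sym.
  - by rewrite eq eqxx in ij.
have close : `|complex.Re (l ^+ j.+1) - complex.Re (l ^+ i.+1)| <= 2 / M%:R.
  have /(congr1 val) /= tij := fij.
  have := truncn_itv (r0 i.+1); have := truncn_itv (r0 j.+1).
  rewrite tij -natr1 => /andP[j1 j2] /andP[i1 i2].
  have : `|r j.+1 - r i.+1| <= 1 by rewrite ler_norml; apply/andP; split; lra.
  rewrite /r -mulrBl opprD addrACA subrr addr0 normrM.
  rewrite [X in _ * X]ger0_norm ?divr_ge0 //.
  by rewrite -ler_pdivlMr ?divr_gt0 // invfM invrK mul1r mulrC.
have prod : rnorm (l ^+ (j - i) - 1) * rnorm (l ^+ (j.+1 + i.+1) - 1) <= e ^+ 2.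
  have -> : rnorm (l ^+ (j - i) - 1) = rnorm (l ^+ j.+1 - l ^+ i.+1).
    have -> : l ^+ j.+1 - l ^+ i.+1 = l ^+ i.+1 * (l ^+ (j - i) - 1).
      by rewrite mulrBr -exprD mulr1 -subSS subnKC // ltnW.
    by rewrite rnormM !lX !mul1r.
  rewrite exprD rnorm_unimodular_Re //.
  apply: le_trans Me; have -> : 4 / M%:R = 2 * (2 / M%:R) :> R by ring.
  by rewrite ler_wpM2l.
have [|far] := lerP (rnorm (l ^+ (j - i) - 1)) e.
  move=> near; exists (j - i)%N; split => //; first by rewrite subn_gt0.
  by have := ltn_ord j; lia.
exists (j.+1 + i.+1)%N; split => //.
  by have := ltn_ord j; have := ltn_ord i; lia.
rewrite leNgt; apply/negP => far'; move: prod; rewrite leNgt => /negP; apply.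
by rewrite expr2 ltr_pM // ltW.
Qed.

End Circle.

(** * From the circle to its exterior and back *)

Section LowerBounds.
Context {R : realType} {V : normedModType R[i]}.
Implicit Types (T : {linear V -> V}) (l w z : R[i]).

(** Outside the circle (l - T) x has norm at least (|l| - 1) |x|, which
    dominates unless |l| - 1 is small compared with d; then l / |l| is a
    good enough approximation of l.  The constant balances both bounds. *)
Lemma exterior_of_circle T (d : R[i] -> R) (c : R) :
  contraction T -> 0 < c -> (forall l w, d l <= d w + rnorm (l - w)) ->
  (forall l x, rnorm l = 1 -> c * d l * rnorm x <= rnorm (l *: x - T x)) ->
  forall l x, 1 <= rnorm l ->
    c / (c + 2) * d l * rnorm x <= rnorm (l *: x - T x).
Proof.
move=> Tc c0 dL cP l x l1; set r := rnorm l.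
have r0 : 0 < r by exact: lt_le_trans l1.
have rC0 : r%:C%C != 0 by rewrite eq_complex /= eqxx andbT gt_eqF.
pose w := (r%:C%C)^-1 * l.
have lE : l = r%:C%C * w by rewrite mulrA divff // mul1r.
have w1 : rnorm w = 1.
  apply: (@mulfI _ r); first by rewrite gt_eqF.
  by rewrite mulr1 {2}/r lE rnormM rnorm_real gtr0_norm.
have lw : l - w = (r - 1)%:C%C * w by rewrite {1}lE rmorphB rmorph1; ring.
have dw := dL l w.
rewrite lw rnormM w1 mulr1 rnorm_real ger0_norm ?subr_ge0 // in dw.
have y1 : (r - 1) * rnorm x <= rnorm (l *: x - T x).
  apply: le_trans (lerB_rnorm _ _); rewrite rnormZ mulrBl mul1r lerD2l lerN2.
  exact: Tc.
have y2 : c * d w * rnorm x - (r - 1) * rnorm x <= rnorm (l *: x - T x).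
  apply: le_trans (_ : rnorm (w *: x - T x) - rnorm ((l - w) *: x) <= _).
    rewrite rnormZ lw rnormM w1 mulr1 rnorm_real ger0_norm ?subr_ge0 //.
    by rewrite lerD2r cP.
  have -> : l *: x - T x = (w *: x - T x) + (l - w) *: x.
    by rewrite scalerBl [RHS]addrC subrKA.
  exact: lerB_rnormD.
have x0 := rnorm_ge0 x; set y := rnorm (l *: x - _) in y1 y2 *.
have -> : c / (c + 2) * d l * rnorm x = c * d l * rnorm x / (c + 2) by ring.
rewrite ler_pdivrMr; last lra.
have : d l * rnorm x <= (d w + (r - 1)) * rnorm x by rewrite ler_wpM2r.
nra.
Qed.

Lemma circle_of_exterior T (d : R[i] -> R) (c : R) :
  contraction T -> 0 < c -> (forall l w, d l <= d w + rnorm (l - w)) ->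
  (forall l x, 1 < rnorm l -> c * d l * rnorm x <= rnorm (l *: x - T x)) ->
  forall l x, rnorm l = 1 -> c * d l * rnorm x <= rnorm (l *: x - T x).
Proof.
move=> Tc c0 dL cP l x l1; apply/ler_addgt0Pr => e e0.
have x0 := rnorm_ge0 x.
pose t := e / ((1 + c) * (rnorm x + 1)).
have t0 : 0 < t by rewrite divr_gt0 // mulr_gt0 //; lra.
have tE : (1 + c) * rnorm x * t <= e.
  rewrite /t mulrA ler_pdivrMr; last by rewrite mulr_gt0 //; lra.
  nra.
pose w := (1 + t)%:C%C * l.
have wl : w - l = t%:C%C * l by rewrite /w rmorphD rmorph1; ring.
have lw : rnorm (l - w) = t.
  by rewrite rnormBC wl rnormM l1 mulr1 rnorm_real gtr0_norm.
have w1 : 1 < rnorm w.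
  by rewrite rnormM l1 mulr1 rnorm_real gtr0_norm; lra.
have := cP w x w1; have := dL l w; rewrite lw => dl cw.
have : rnorm (w *: x - T x) <= rnorm (l *: x - T x) + t * rnorm x.
  have -> : w *: x - T x = (l *: x - T x) + (w - l) *: x.
    by rewrite scalerBl [RHS]addrC subrKA.
  apply: le_trans (ler_rnormD _ _) _.
  by rewrite rnormZ (rnormBC w) lw.
have : d l * rnorm x <= (d w + t) * rnorm x by rewrite ler_wpM2r.
nra.
Qed.

(** * Lower bounds away from the roots of unity of odd order *)

Lemma below_of_expr_near_opp1 T (e : R) l n : contraction T -> (0 < n)%N ->
  (forall x, e * rnorm x <= rnorm (x + iter n T x)) ->
  rnorm l = 1 -> rnorm (l ^+ n + 1) <= e / 2 ->
  forall x, e / 2 * rnorm x <= n%:R * rnorm (l *: x - T x).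
Proof.
move=> Tc n0 eP l1 ln x; apply: le_trans (rnorm_pow_sub n x Tc l1).
have -> : l ^+ n *: x - iter n T x = (l ^+ n + 1) *: x - (x + iter n T x).
  by rewrite scalerDl scale1r opprD addrA addrK.
rewrite rnormBC; apply: le_trans (lerB_rnorm _ _); rewrite rnormZ.
have := eP x; have := rnorm_ge0 x; nra.
Qed.

Lemma rnorm_expr_sub1 w k : rnorm w = 1 ->
  rnorm (w ^+ k - 1) <= k%:R * rnorm (w - 1).
Proof.
move=> w1; elim: k => [|k IH]; first by rewrite subrr rnorm0 mul0r.
have -> : w ^+ k.+1 - 1 = w ^+ k * (w - 1) + (w ^+ k - 1) by rewrite exprSr; ring.
apply: le_trans (ler_rnormD _ _) _.
by rewrite rnormM rnormX w1 expr1n -natr1 mulrDl addrC lerD // mul1r.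
Qed.

(** The weight |l^N - 1| is comparable with the distance from l to the N-th
    roots of unity; unlike the distance it factors when N does. *)
Definition unity_below T N := exists2 c : R, 0 < c &
  forall l x, rnorm l = 1 ->
    c * rnorm (l ^+ N - 1) * rnorm x <= rnorm (l *: x - T x).

(** The factor l^M + 1 of l^(2M) - 1 can be dropped: where it is small, l^M is
    close to -1, and l - T is bounded below. *)
Lemma unity_below_half T (e : R) M : contraction T -> 0 < e -> (0 < M)%N ->
  (forall x, e * rnorm x <= rnorm (x + iter M T x)) ->
  unity_below T (M * 2) -> unity_below T M.
Proof.
move=> Tc e0 M0 eP [c c0 cP].
have Mr0 : 0 < M%:R :> R by rewrite ltr0n.
exists (Num.min (c * (e / 2)) (e / (4 * M%:R))).
  by rewrite lt_min mulr_gt0 ?divr_gt0 // mulr_gt0.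
move=> l x l1; have x0 := rnorm_ge0 x; have lM0 := rnorm_ge0 (l ^+ M - 1).
have [near|far] := leP (rnorm (l ^+ M + 1)) (e / 2).
  have := below_of_expr_near_opp1 Tc M0 eP l1 near x => below.
  have lM2 : rnorm (l ^+ M - 1) <= 2.
    by apply: le_trans (ler_rnormB _ _) _; rewrite rnormX l1 expr1n rnorm1.
  apply: le_trans (_ : e / (4 * M%:R) * 2 * rnorm x <= _).
    rewrite ler_wpM2r // ler_pM ?ge_min ?lexx ?orbT //.
    by rewrite le_min !mulr_ge0 ?invr_ge0 // ltW.
  rewrite -(ler_pM2l Mr0); apply: le_trans below.
  by rewrite le_eqVlt; apply/orP; left; apply/eqP; field; rewrite gt_eqF.
apply: le_trans (cP l x l1); rewrite exprM.
have -> : l ^+ M ^+ 2 - 1 = (l ^+ M + 1) * (l ^+ M - 1) by ring.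
rewrite rnormM ler_wpM2r // [leRHS]mulrA ler_wpM2r // ge_min; apply/orP; left.
by rewrite ler_wpM2l // ltW.
Qed.

(** Dirichlet's theorem brings some power l^m with m <= Q close to 1, and from
    there a power of l^m reaches the vicinity of -1.  The exponent Q! is a
    common multiple of all possible m. *)
Lemma unity_below_fact T (e : R) : contraction T -> 0 < e ->
  (forall n x, (0 < n)%N -> e * rnorm x <= rnorm (x + iter n T x)) ->
  exists Q, unity_below T Q`!.
Proof.
move=> Tc e0 eP; have e80 : 0 < e / 8 by rewrite divr_gt0.
have [Q [Q0 QP]] := exists_expr_near1 e80.
exists Q; have QF0 : 0 < (Q`!)%:R :> R by rewrite ltr0n fact_gt0.
exists (e / (24 * (Q`!)%:R)); first by rewrite divr_gt0 // mulr_gt0.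
move=> l x l1; have [m [m0 mQ mP]] := QP l l1.
have x0 := rnorm_ge0 x; have y0 := rnorm_ge0 (l *: x - T x).
have [p pE] : exists p, Q`! = (m * p)%N.
  have /dvdnP[p ->] : (m %| Q`!)%N by rewrite dvdn_fact // m0.
  by exists p; rewrite mulnC.
have lm1 : rnorm (l ^+ m) = 1 by rewrite rnormX l1 expr1n.
have := rnorm_expr_sub1 p lm1; rewrite -exprM -pE.
have [->|lm] := eqVneq (l ^+ m) 1.
  rewrite subrr rnorm0 mulr0 => le0.
  have -> : rnorm (l ^+ Q`! - 1) = 0 by apply/le_anti; rewrite le0 rnorm_ge0.
  by rewrite mulr0 mul0r.
have [k [k0 kP kN]] := exists_expr_near_opp1 lm1 lm.
have mk0 : (0 < m * (k * 3))%N by rewrite !muln_gt0 m0 k0.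
have near : rnorm (l ^+ (m * (k * 3)) + 1) <= e / 2.
  by rewrite exprM; apply: le_trans kN _; lra.
have := below_of_expr_near_opp1 Tc mk0 (fun x => eP _ x mk0) l1 near x.
rewrite pE !natrM; set s := rnorm (l ^+ m - 1) in kP mP kN *.
set y := rnorm (l *: x - T x) in y0 *; set X := rnorm x in x0 *.
set S := rnorm (_ - 1); move=> below le_S.
have m0r : 0 < m%:R :> R by rewrite ltr0n.
have p0r : 0 < p%:R :> R.
  by rewrite ltr0n lt0n; apply: contraTneq (fact_gt0 Q) => p0; rewrite pE p0 muln0.
have s0 : 0 < s by rewrite rnorm_gt0 // subr_eq0.
have -> : e / (24 * (m%:R * p%:R)) * S * X =
  e * S * X / (24 * (m%:R * p%:R)) by ring.
rewrite ler_pdivrMr ?mulr_gt0 //.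
apply: le_trans (_ : e * (p%:R * s) * X <= _).
  by rewrite ler_wpM2r // ler_wpM2l // ltW.
have : e / 2 * X * s <= m%:R * y * 12.
  apply: le_trans (_ : m%:R * (k%:R * 3) * y * s <= _).
    by rewrite ler_wpM2r // ltW.
  have -> : m%:R * (k%:R * 3) * y * s = m%:R * y * (3 * (k%:R * s)) by ring.
  by rewrite ler_wpM2l ?mulr_ge0 //; lra.
move=> H; have := ler_wpM2l (ltW p0r) H; nra.
Qed.

(** The points of the circle near which l - T can degenerate are roots of unity
    of bounded order by Dirichlet's theorem, and this order is odd since the
    roots of unity of even order have a power equal to -1. *)
Lemma odd_unity_below T (e : R) : contraction T -> 0 < e ->
  (forall n x, (0 < n)%N -> e * rnorm x <= rnorm (x + iter n T x)) ->
  exists N, odd N /\ unity_below T N.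
Proof.
move=> Tc e0 eP; have [Q] := unity_below_fact Tc e0 eP.
have := fact_gt0 Q; elim/ltn_ind: (Q`!) => N IH N0 NP.
case: (boolP (odd N)) => [oN|/negbTE eN]; first by exists N.
have NE : N = (N./2 * 2)%N by rewrite muln2 -{1}(odd_double_half N) eN.
apply: (IH N./2); [lia | lia | ].
apply: (unity_below_half Tc e0); [lia | move=> x; apply: eP; lia |].
by rewrite -NE.
Qed.

End LowerBounds.

(** * Surjectivity in Banach spaces *)

Section Complete.
Context {R : realType}.

Lemma exists_geometric_small (K q e : R) : 0 <= q -> q < 1 -> 0 < e ->
  exists n, K * q ^+ n < e.
Proof.
move=> q0 q1 e0; have : (K * q ^+ n @[n --> \oo] --> K * 0).
  by apply: cvgMr; apply: cvg_expr; rewrite ger0_norm.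
rewrite mulr0 => /cvgrPdist_lt/(_ _ e0)/filter_ex[n /=].
by rewrite sub0r normrN => /(le_lt_trans (ler_norm _)); exists n.
Qed.

Lemma exists_sum_geometric (V : completeNormedModType R[i]) (u : nat -> V)
    (C q : R) :
  0 <= C -> 0 <= q -> q < 1 -> (forall k, rnorm (u k) <= C * q ^+ k) ->
  exists x, forall n,
    rnorm (x - \sum_(k < n) u k) <= C * q ^+ n / (1 - q).
Proof.
move=> C0 q0 q1 uC; pose s n := \sum_(k < n) u k.
have q1' : 0 < 1 - q by rewrite subr_gt0.
have sP n p : rnorm (s (n + p)%N - s n) <= C * q ^+ n / (1 - q).
  apply: le_trans (_ : C * q ^+ n * (1 - q ^+ p) / (1 - q) <= _); last first.
    rewrite ler_pM2r ?invr_gt0 // -[leRHS]mulr1 ler_wpM2l //.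
      by rewrite mulr_ge0 ?exprn_ge0.
    by rewrite gerBl exprn_ge0.
  elim: p => [|p IH]; first by rewrite addn0 !subrr rnorm0 mulr0 mul0r.
  have -> : s (n + p.+1)%N - s n = (s (n + p)%N - s n) + u (n + p)%N.
    by rewrite /s addnS big_ord_recr /= addrAC.
  apply: le_trans (ler_rnormD _ _) _.
  apply: le_trans (lerD IH (uC _)) _; rewrite exprD.
  suff -> : C * q ^+ n * (1 - q ^+ p.+1) / (1 - q) =
    C * q ^+ n * (1 - q ^+ p) / (1 - q) + C * (q ^+ n * q ^+ p) by [].
  by rewrite exprS; field; rewrite gt_eqF.
have small (e : R) : 0 < e -> exists n, C * q ^+ n / (1 - q) < e.
  move=> e0; have [n nP] := exists_geometric_small (C / (1 - q)) q0 q1 e0.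
  by exists n; rewrite mulrAC.
have scvg : cvgn s.
  apply: cauchy_cvg; apply: cauchy_exP => e e0.
  have eE : e = (complex.Re e)%:C%C by rewrite RRe_real // gtr0_real.
  have [n nP] : exists n, C * q ^+ n / (1 - q) < complex.Re e.
    by apply: small; rewrite -ltcR -eE.
  exists (s n); exists n => // m /= nm.
  rewrite -ball_normE /= norm_rnorm eE ltcR rnormBC -(subnKC nm).
  exact: le_lt_trans (sP _ _) nP.
case/cvg_ex : scvg => x xP; exists x => n.
apply/ler_addgt0Pr => e e0.
have e0c : 0 < e%:C%C by rewrite ltcR.
have [N _ NP] := (iffLR (@cvgrPdist_lt _ _ _ _ _ _ _)) xP _ e0c.
have := NP (n + N)%N (leq_addl _ _); rewrite /= norm_rnorm ltcR => /ltW xN.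
have -> : x - s n = (s (n + N)%N - s n) + (x - s (n + N)%N).
  by rewrite [RHS]addrC subrKA.
by apply: le_trans (ler_rnormD _ _) _; apply: lerD.
Qed.

(** Stability of surjectivity under perturbations smaller than the lower
    bound; the residuals of the approximate solutions decay geometrically. *)
Lemma surjective_perturbation (V : completeNormedModType R[i])
    (A B : {linear V -> V}) (a b M : R) :
  0 <= a -> a < b -> 0 <= M -> (forall x, rnorm (A x) <= M * rnorm x) ->
  (forall y, exists x, B x = y) ->
  (forall x, b * rnorm x <= rnorm (B x)) ->
  (forall x, rnorm (B x - A x) <= a * rnorm x) ->
  forall y, exists x, A x = y.
Proof.
move=> a0 ab M0 AM Bsurj Bb AB y.
have b0 : 0 < b by exact: le_lt_trans ab.
have [g gP] := choice Bsurj.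
have gb z : rnorm (g z) <= rnorm z / b.
  by rewrite ler_pdivlMr // mulrC -{2}(gP z) Bb.
pose r k := iter k (fun z => z - A (g z)) y.
set q := a / b.
have q0 : 0 <= q by rewrite divr_ge0 // ltW.
have q1 : q < 1 by rewrite ltr_pdivrMr // mul1r.
have rP k : rnorm (r k) <= q ^+ k * rnorm y.
  elim: k => [|k IH]; first by rewrite expr0 mul1r.
  rewrite /r iterS -/(r k) -{1}(gP (r k)); apply: le_trans (AB _) _.
  rewrite exprS -mulrA; apply: le_trans (ler_wpM2l a0 (gb _)) _.
  by rewrite mulrCA mulrC -/q ler_wpM2l.
have C0 : 0 <= rnorm y / b by rewrite divr_ge0 ?rnorm_ge0 ?ltW.
have [x xP] : exists x, forall n,
    rnorm (x - \sum_(k < n) g (r k)) <= rnorm y / b * q ^+ n / (1 - q).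
  apply: (@exists_sum_geometric V (g \o r)) => // k; apply: le_trans (gb _) _.
  by rewrite mulrAC ler_pM2r ?invr_gt0 // mulrC.
have AS n : A (\sum_(k < n) g (r k)) = y - r n.
  elim: n => [|n IH]; first by rewrite big_ord0 linear0 subrr.
  have rS : r n.+1 = r n - A (g (r n)) by [].
  by rewrite rS big_ord_recr linearD /= IH opprB addrA addrAC.
exists x; apply/eqP; rewrite -subr_eq0; apply/eqP/rnorm0_eq0/le_anti.
rewrite rnorm_ge0 andbT; apply/ler_addgt0Pr => e e0; rewrite add0r.
have [n nP] := exists_geometric_small
  (M * (rnorm y / b / (1 - q)) + rnorm y) q0 q1 e0.
apply: ltW; apply: le_lt_trans nP.
have -> : A x - y = A (x - \sum_(k < n) g (r k)) - r n.
  by rewrite linearB AS /= opprB addrA addrAC addrK.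
apply: le_trans (ler_rnormB _ _) _; rewrite mulrDl.
apply: lerD; last by rewrite mulrC rP.
apply: le_trans (AM _) _.
by rewrite -mulrA ler_wpM2l //; apply: le_trans (xP n) _; rewrite mulrAC.
Qed.

End Complete.

Section UniformInverse.
Context {R : realType} {V : completeNormedModType R[i]}.
Implicit Types (T S : {linear V -> V}) (l : R[i]).

Lemma surjective_exterior T l : contraction T -> 1 < rnorm l ->
  forall y, exists x, l *: x - T x = y.
Proof.
move=> Tc l1.
have l0 : l != 0.
  by apply: contraTneq l1 => ->; rewrite rnorm0 -leNgt ler01.
apply: (@surjective_perturbation R V (GRing.scale l \- T : {linear V -> V})
  (GRing.scale l : {linear V -> V}) 1 (rnorm l) (rnorm l + 1)) => //.
- by rewrite addr_ge0 ?rnorm_ge0.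
- move=> x /=; apply: le_trans (ler_rnormB _ _) _.
  by rewrite rnormZ mulrDl mul1r lerD2l.
- by move=> y; exists (l^-1 *: y); rewrite /= scalerA divff // scale1r.
- by move=> x /=; rewrite rnormZ.
- by move=> x /=; rewrite subKr mul1r.
Qed.

(** * Uniform bound for the inverses of I + S^n *)

Lemma ler1_expr1D (a : R) n : 0 <= a -> 1 + n%:R * a <= (1 + a) ^+ n.
Proof.
move=> a0; elim: n => [|n IH]; first by rewrite mul0r addr0.
have n0 : 0 <= n%:R :> R by [].
rewrite exprS -natr1; have : 0 <= n%:R * a * a by rewrite !mulr_ge0.
nra.
Qed.

(** Let w run through the n-th roots of -1 and put t = 1 + 1/n.  The inverses
    of I + S^n and I + S^n / t^n are the averages over w of
    w (w - S)^-1 and t w (t w - S)^-1.  The second one is bounded by 2 since S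
    is a contraction.  By the resolvent identity the summands differ by at most
    (1/n) / |w - 1|^2 up to a constant, and these bounds add up to n / 4. *)
Lemma rnorm_I_add_pow_ge S (c : R) n x : contraction S -> 0 < c ->
  (forall l y, 1 <= rnorm l ->
    c * rnorm (l - 1) * rnorm y <= rnorm (l *: y - S y)) ->
  (0 < n)%N ->
  rnorm x <= (2 + (4 * c ^+ 2)^-1) * rnorm (x + iter n S x).
Proof.
move=> Sc c0 cP n0; set y := x + iter n S x.
have [z zP] := @exists_prim_root R _ n0.
have wn := rootCK n0 (-1 : R[i]); set w0 := n.-root _ in wn.
have nr0 : 0 < n%:R :> R by rewrite ltr0n.
pose t : R := 1 + n%:R^-1.
have n10 : 0 < n%:R^-1 :> R by rewrite invr_gt0.
have t1 : 1 < t by rewrite /t; lra.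
have t0 : 0 < t by rewrite (lt_trans ltr01).
have t0' := ltW t0.
have tn : 2 <= t ^+ n.
  by have := ler1_expr1D n (ltW n10); rewrite divff ?gt_eqF.
pose w i := w0 * z ^+ i.
have wX i : w i ^+ n = -1.
  by rewrite exprMn wn [_ ^+ i ^+ n]exprAC (prim_expr_order zP) expr1n mulr1.
have w1 i : rnorm (w i) = 1.
  by apply: (rnorm_expr_eq1 n0); rewrite wX rnormN rnorm1.
have twE i : t%:C%C * w0 * z ^+ i = t%:C%C * w i by rewrite /w mulrA.
have w_neq1 i : 0 < rnorm (w i - 1).
  rewrite rnorm_gt0 // subr_eq0; apply: contra_eq_neq (wX i) => ->.
  by rewrite expr1n -addr_eq0 (_ : 1 + 1 = 2%:R) // pnatr_eq0.
have far i : rnorm (w i - 1) <= rnorm (t%:C%C * w i - 1).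
  rewrite -(@ler_pXn2r _ 2) ?nnegrE ?rnorm_ge0 // !rnorm_sqr.
  have := rnorm_sqr (w i); rewrite w1 expr1n; case: (w i) => a b /= ab.
  have a1 : a <= 1 by have := sqr_ge0 b; nra.
  have : (t * a - 0 * b - 1) ^+ 2 + (t * b + 0 * a) ^+ 2 =
    (t - 1) ^+ 2 + t * ((a - 1) ^+ 2 + b ^+ 2) by nra.
  have := sqr_ge0 (t - 1); have := sqr_ge0 (a - 1); have := sqr_ge0 b.
  rewrite !subr0; nra.
have [|v vP] := surjective_exterior (l := - (t ^+ n)%:C%C)
    (contraction_iter n Sc) _ (- y).
  by rewrite rnormN rnorm_real ger0_norm ?exprn_ge0 ?ltW //; lra.
have v_le : t ^+ n * rnorm v <= 2 * rnorm y.
  have : (t ^+ n - 1) * rnorm v <= rnorm y.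
    rewrite -(rnormN y) -vP; apply: le_trans (lerB_rnorm _ _).
    rewrite rnormZ rnormN rnorm_real ger0_norm ?exprn_ge0 //.
    by rewrite mulrBl mul1r lerD2l lerN2; apply: contraction_iter.
  have := rnorm_ge0 v; nra.
(* - u i and - q i are the values at y of the resolvents of S at w i and at
   t * w i *)
pose u i := divdiff S (w i) n x.
pose q i := divdiff S (t%:C%C * w i) n v.
have uP i : w i *: u i - S (u i) = - y.
  by rewrite divdiffP wX scaleN1r opprD.
have qP i : (t%:C%C * w i) *: q i - S (q i) = - y.
  rewrite divdiffP exprMn wX mulrN1 -vP; congr (- _ *: _ - _).
  by rewrite rmorphXn.
have eP i : (t%:C%C * w i) *: (q i - u i) - S (q i - u i) =
    - ((t - 1)%:C%C * w i) *: u i.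
  have tu : (t%:C%C * w i) *: u i - S (u i) = ((t - 1)%:C%C * w i) *: u i - y.
    rewrite -(uP i) addrA -scalerDl; congr (_ *: _ - _).
    by rewrite rmorphB rmorph1; ring.
  have -> : S (q i - u i) = S (q i) - S (u i) by rewrite linearB.
  by rewrite scalerBr opprD addrACA -opprD qP tu opprB addKr scaleNr.
have dP i : (t%:C%C * w i) *: q i - w i *: u i = S (q i - u i).
  have Sq : S (q i) = (t%:C%C * w i) *: q i + y.
    by rewrite -[y]opprK -(qP i) opprB subrKC.
  have Su : S (u i) = w i *: u i + y by rewrite -[y]opprK -(uP i) opprB subrKC.
  by rewrite linearB Sq Su opprD addrACA subrr addr0.
have u_le i : c * rnorm (w i - 1) * rnorm (u i) <= rnorm y.
  by rewrite -(rnormN y) -(uP i) cP // w1.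
have d_le i : rnorm ((t%:C%C * w i) *: q i - w i *: u i) <=
    rnorm y / (n%:R * c ^+ 2) * (rnorm (w i - 1) ^+ 2)^-1.
  rewrite dP; apply: le_trans (Sc _) _; set e := q i - u i.
  have : c * rnorm (w i - 1) * rnorm e <= n%:R^-1 * rnorm (u i).
    apply: le_trans (_ : c * rnorm (t%:C%C * w i - 1) * rnorm e <= _).
      by rewrite ler_wpM2r ?rnorm_ge0 // ler_wpM2l // ltW.
    have -> : n%:R^-1 * rnorm (u i) = rnorm (- ((t - 1)%:C%C * w i) *: u i).
      rewrite rnormZ rnormN rnormM w1 rnorm_real mulr1 ger0_norm /t.
        by congr (_ * _); ring.
      by rewrite addrC addKr ltW.
    by rewrite -eP; apply: cP; rewrite rnormM w1 rnorm_real mulr1 gtr0_norm // ltW.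
  have := u_le i; have := w_neq1 i; set D := rnorm (w i - 1) => D0 uy eu.
  rewrite -mulrA -invfM ler_pdivlMr ?mulr_gt0 ?exprn_gt0 //.
  have := ler_wpM2l (mulr_ge0 (ltW nr0) (mulr_ge0 (ltW c0) (ltW D0))) eu.
  have -> : n%:R * (c * D) * (n%:R^-1 * rnorm (u i)) = c * D * rnorm (u i).
    by field; rewrite gt_eqF.
  move=> /le_trans/(_ uy); apply: le_trans.
  by rewrite le_eqVlt; apply/orP; left; apply/eqP; ring.
have sum_u : \sum_(i < n) w i *: u i = - (n%:R *: x).
  by rewrite /u /w (sum_divdiff_roots S w0 x zP) wn mulrN1 scaleNr.
have sum_q : \sum_(i < n) (t%:C%C * w i) *: q i = - ((n%:R * t ^+ n)%:C%C *: v).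
  under eq_bigr => i _ do rewrite /q -twE.
  rewrite (sum_divdiff_roots S (t%:C%C * w0) v zP) exprMn wn mulrN1 mulrN scaleNr.
  by rewrite rmorphM rmorph_nat rmorphXn.
have : n%:R * rnorm x <= n%:R * (t ^+ n * rnorm v) +
    \sum_(i < n) rnorm ((t%:C%C * w i) *: q i - w i *: u i).
  have -> : n%:R * rnorm x = rnorm (\sum_(i < n) w i *: u i).
    by rewrite sum_u rnormN rnormZ rnorm_nat.
  have -> : n%:R * (t ^+ n * rnorm v) =
      rnorm (\sum_(i < n) (t%:C%C * w i) *: q i).
    rewrite sum_q rnormN rnormZr ?mulrA // mulr_ge0 ?exprn_ge0 //; exact: ltW.
  rewrite -lerBlDl; apply: le_trans (ler_rnorm_sum _ _ _).
  by rewrite sumrB rnormBC lerB_rnorm.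
have : \sum_(i < n) rnorm ((t%:C%C * w i) *: q i - w i *: u i) <=
    n%:R * ((4 * c ^+ 2)^-1 * rnorm y).
  apply: le_trans (_ : \sum_(i < n)
    rnorm y / (n%:R * c ^+ 2) * (rnorm (w i - 1) ^+ 2)^-1 <= _).
    by apply: ler_sum => i _; apply: d_le.
  rewrite -mulr_sumr (sum_inv_sqr_dist_roots zP wn).
  rewrite le_eqVlt; apply/orP; left; apply/eqP; field.
  by rewrite !gt_eqF.
move=> le1 le2; rewrite -(ler_pM2l nr0); apply: le_trans le2 _.
apply: le_trans (lerD (ler_wpM2l (ltW nr0) v_le) le1) _.
by rewrite -mulrDr -mulrDl.
Qed.

End UniformInverse.

(** * Lower bounds relative to roots of unity *)

Section RootsOfUnity.
Context {R : realType}.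
Implicit Types (l w z : R[i]) (E : set R[i]).

Lemma power_below_of_unity (V : normedModType R[i]) (T : {linear V -> V}) N :
  (0 < N)%N -> unity_below T N -> exists2 c : R, 0 < c &
  forall l x, rnorm l = 1 ->
    c * rnorm (l - 1) * rnorm x <= rnorm (l *: x - iter N T x).
Proof.
move=> N0 [c c0 cP]; exists c => // l x l1.
have [z zP] := @exists_prim_root R _ N0.
have lN := rootCK N0 l; set w := N.-root l in lN.
have w1 : rnorm w = 1 by apply: (rnorm_expr_eq1 N0); rewrite lN.
have z1 : rnorm z = 1.
  by apply: (rnorm_expr_eq1 N0); rewrite (prim_expr_order zP) rnorm1.
rewrite -lN; apply: (below_pow _ zP w1); first by rewrite mulr_ge0 ?rnorm_ge0 ?ltW.
move=> i y; have -> : w ^+ N = (w * z ^+ i) ^+ N.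
  by rewrite exprMn [_ ^+ i ^+ N]exprAC (prim_expr_order zP) expr1n mulr1.
by apply: cP; rewrite rnormM rnormX w1 z1 expr1n mulr1.
Qed.

Lemma dist_to_le E l z : E z -> dist_to l E <= rnorm (l - z).
Proof.
move=> Ez; apply: ge_inf; last by exists z.
by exists 0 => _ [w _ <-]; apply: rnorm_ge0.
Qed.

Lemma le_dist_to E l (a : R) : E !=set0 ->
  (forall z, E z -> a <= rnorm (l - z)) -> a <= dist_to l E.
Proof.
move=> [z Ez] aP; apply: lb_le_inf; first by exists (rnorm (l - z)), z.
by move=> _ [w Ew <-]; apply: aP.
Qed.

Lemma dist_to_ge0 E l : E !=set0 -> 0 <= dist_to l E.
Proof. by move=> E0; apply: le_dist_to => // z _; apply: rnorm_ge0. Qed.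

Lemma dist_to_lipschitz E l w : E !=set0 ->
  dist_to l E <= dist_to w E + rnorm (l - w).
Proof.
move=> E0; rewrite -lerBlDr; apply: le_dist_to => // z Ez.
rewrite lerBlDr; apply: le_trans (dist_to_le l Ez) _.
by rewrite [leRHS]addrC -(subrKA w l (- z)) ler_rnormD.
Qed.

(** Partial fractions for the one-dimensional operator of multiplication
    by l. *)
Lemma dist_to_unity_roots N l : (0 < N)%N ->
  dist_to l [set z | z ^+ N = 1] <= rnorm (l ^+ N - 1).
Proof.
move=> N0; have [z zP] := @exists_prim_root R _ N0.
have := @below_pow R (R[i]^o) (GRing.scale l) N z 1
  (dist_to l [set z | z ^+ N = 1]) 1 zP rnorm1.
have -> : iter N (GRing.scale l) 1 = l ^+ N.
  by elim: N {N0 zP} => // n IH; rewrite iterS IH exprS.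
rewrite rnorm1 mulr1 expr1n scale1r rnormBC; apply.
  by apply: dist_to_ge0; exists 1; rewrite /= expr1n.
move=> i x; rewrite mul1r -scalerBl rnormZ ler_wpM2r ?rnorm_ge0 //.
rewrite rnormBC; apply: dist_to_le.
by rewrite /= exprAC (prim_expr_order zP) expr1n.
Qed.

Lemma finite_unity_roots N : (0 < N)%N ->
  finite_set [set z : R[i] | z ^+ N = 1].
Proof.
move=> N0; have [z zP] := @exists_prim_root R _ N0.
apply/finite_seqP; exists [seq z ^+ i | i <- index_iota 0 N].
apply/seteqP; split => w /=.
  by move=> /(prim_rootP zP)[i ->]; apply: map_f; rewrite mem_index_iota ltn_ord.
by move=> /mapP[i _ ->]; rewrite exprAC (prim_expr_order zP) expr1n.
Qed.

Lemma exists_common_odd_order E : finite_set E ->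
  (forall z, E z -> exists m, odd m /\ m.-primitive_root z) ->
  exists N, odd N /\ forall z, E z -> z ^+ N = 1.
Proof.
move=> /finite_seqP[s ->] /=; elim: s => [|z s IH] sP.
  by exists 1%N; split.
have [|N [oN NP]] := IH; first by move=> w ws; apply: sP; rewrite inE ws orbT.
have [m [om mP]] := sP z (mem_head _ _).
exists (m * N)%N; rewrite oddM om oN; split => // w; rewrite inE.
case/orP => [/eqP ->|ws]; first by rewrite exprM (prim_expr_order mP) expr1n.
by rewrite exprM exprAC NP // expr1n.
Qed.

Lemma rnorm_expr_sub1_dist_to E N l : E !=set0 ->
  (forall z, E z -> rnorm z = 1 /\ z ^+ N = 1) -> rnorm l = 1 ->
  rnorm (l ^+ N - 1) <= N%:R * dist_to l E.
Proof.
move=> E0 EP l1; case: (posnP N) => [->|N0].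
  by rewrite subrr rnorm0 mul0r.
rewrite -ler_pdivrMl ?ltr0n //; apply: le_dist_to => // z Ez.
rewrite ler_pdivrMl ?ltr0n //; have [z1 zN] := EP z Ez.
have z0 : z != 0.
  by apply: contra_eq_neq z1 => ->; rewrite rnorm0 eq_sym oner_neq0.
have -> : l ^+ N = (l / z) ^+ N by rewrite exprMn exprVn zN invr1 mulr1.
have -> : rnorm (l - z) = rnorm (l / z - 1).
  by rewrite -[RHS]mulr1 -z1 -rnormM mulrBl divfK // mul1r.
apply: rnorm_expr_sub1.
apply: (mulIf (_ : rnorm z != 0)); first by rewrite z1 oner_neq0.
by rewrite -rnormM divfK // z1 l1 mulr1.
Qed.

End RootsOfUnity.


(** * Ritt conditions as lower bounds *)

Section OperatorNorm.
Context {R : realType} {X : completeNormedModType R[i]}.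
Implicit Types (A T : {linear X -> X}) (l : R[i]) (d : R[i] -> R).

Lemma linear_pack (f : X -> X) : linear f -> exists A, f = A.
Proof.
move=> fL; pose F := GRing.isLinear.Build R[i] X X _ f fL.
by exists (HB.pack_for {linear X -> X} f F).
Qed.

Lemma opnorm_leP A (M : R) : 0 <= M ->
  (opnorm A <= M%:E)%E <-> forall x, rnorm (A x) <= M * rnorm x.
Proof.
move=> M0; split => [AM x|AM].
  have [->|x0] := eqVneq x 0; first by rewrite linear0 !rnorm0 mulr0.
  have nx := rnorm_gt0 x0; have nx' := ltW nx.
  pose y := (rnorm x)^-1%:C%C *: x.
  have y1 : rnorm y = 1 by rewrite rnormZr ?invr_ge0 // mulVf // gt_eqF.
  have : ((rnorm (A y))%:E <= M%:E)%E.
    by apply: le_trans AM; apply: ereal_sup_ubound; exists y; rewrite //= y1.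
  rewrite lee_fin linearZ rnormZr ?invr_ge0 // mulrC.
  by rewrite ler_pdivrMr.
apply: ge_ereal_sup => _ [x /= x1 <-]; rewrite lee_fin.
by apply: le_trans (AM x) _; rewrite ler_piMr.
Qed.

Lemma bounded_operator_of_le A (M : R) :
  (forall x, rnorm (A x) <= M * rnorm x) -> bounded_operator A.
Proof.
move=> AM; split; first by move=> a x y; rewrite linearP.
apply/bounded_linear_continuous/linear_boundedP.
exists M%:C%C; split; first by rewrite complex_real.
move=> r /ltW Mr x; rewrite !norm_rnorm.
apply: le_trans (_ : M%:C%C * (rnorm x)%:C%C <= _).
  by rewrite -rmorphM lecR.
by rewrite ler_wpM2r // ler0c rnorm_ge0.
Qed.

Lemma opinvP A : invertible_op A -> is_opinv A (opinv A).
Proof. by move=> [B BP]; apply: xgetPex; exists B. Qed.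

Lemma invertible_of_below A (K : R) :
  (forall y, exists x, A x = y) -> (forall x, rnorm x <= K * rnorm (A x)) ->
  invertible_op A.
Proof.
move=> /choice[B BP] AK.
have Ainj : injective A.
  move=> x y Axy; apply/eqP; rewrite -subr_eq0; apply/eqP/rnorm0_eq0/le_anti.
  by rewrite rnorm_ge0 andbT (le_trans (AK _)) // linearB Axy subrr rnorm0 mulr0.
have BK : cancel A B by move=> x; apply: Ainj; rewrite BP.
have [B' B'E] : exists B' : {linear X -> X}, B = B'.
  by apply: linear_pack => a x y; apply: Ainj; rewrite linearP !BP.
exists B; split => //; rewrite B'E; apply: (@bounded_operator_of_le _ K) => x.
by rewrite -B'E -{2}(BP x).
Qed.

Lemma opnorm_opinv_leP A (K : R) : invertible_op A -> 0 <= K ->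
  (opnorm (opinv A) <= K%:E)%E <-> forall x, rnorm x <= K * rnorm (A x).
Proof.
move=> /opinvP[[/linear_pack[B ->] _] AB BA] K0.
rewrite opnorm_leP //; split => H x; first by rewrite -{1}(AB x).
by rewrite -{2}(BA x).
Qed.

Lemma opnorm_ge0 (f : X -> X) : (0 <= opnorm f)%E.
Proof.
apply: le_trans (_ : (rnorm (f 0))%:E <= _)%E; first by rewrite lee_fin rnorm_ge0.
by apply: ereal_sup_ubound; exists 0; rewrite //= rnorm0.
Qed.

(** Convertible to [is_Ritt T] for d l = |l - 1|, and to [is_Ritt_on E T] for
    d l = [dist_to l E]. *)
Definition weighted_Ritt T d : Prop :=
  [/\ bounded_operator T,
      spectrum T `<=` [set l | rnorm l <= 1] &
      (ereal_sup [set (d l)%:E * opnorm (resolvent T l)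
                 | l in [set l | 1 < rnorm l]%R] < +oo)%E].

Lemma weighted_Ritt_of_below T d (c : R) : contraction T -> 0 < c ->
  (forall l, 0 <= d l) ->
  (forall l x, 1 < rnorm l -> c * d l * rnorm x <= rnorm (l *: x - T x)) ->
  weighted_Ritt T d.
Proof.
move=> Tc c0 d0 cP.
have inv l : 1 < rnorm l -> invertible_op (GRing.scale l \- T : {linear X -> X}).
  move=> l1; apply: (@invertible_of_below _ (rnorm l - 1)^-1).
    exact: surjective_exterior.
  move=> x; rewrite ler_pdivlMl ?subr_gt0 //; apply: le_trans (lerB_rnorm _ _).
  by rewrite rnormZ mulrBl mul1r lerD2l lerN2.
split.
- by apply: (@bounded_operator_of_le _ 1) => x; rewrite mul1r.
- by move=> l /= lT; rewrite leNgt; apply/negP => /inv.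
apply: le_lt_trans (ltry c^-1); apply: ge_ereal_sup => _ [l /= l1 <-].
have [->|dl] := eqVneq (d l) 0; first by rewrite mul0e lee_fin invr_ge0 ltW.
have dl0 : 0 < d l by rewrite lt_neqAle eq_sym dl d0.
have cd0 : 0 < c * d l by rewrite mulr_gt0.
have : (opnorm (resolvent T l) <= ((c * d l)^-1)%:E)%E.
  apply/(opnorm_opinv_leP (inv l l1)); first by rewrite invr_ge0 ltW.
  by move=> x; rewrite ler_pdivlMl // cP.
have dE0 : (0 <= (d l)%:E)%E by rewrite lee_fin.
move=> /(lee_wpmul2l dE0)/le_trans; apply.
by rewrite -EFinM lee_fin invfM mulrCA mulfV // mulr1.
Qed.

Lemma below_of_weighted_Ritt T d : (forall l, 0 <= d l) -> weighted_Ritt T d ->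
  exists2 c : R, 0 < c &
  forall l x, 1 < rnorm l -> c * d l * rnorm x <= rnorm (l *: x - T x).
Proof.
move=> d0 [_ specT supT].
have [M M0 MP] : exists2 M : R, 0 < M & forall l, 1 < rnorm l ->
    ((d l)%:E * opnorm (resolvent T l) <= M%:E)%E.
  set s := ereal_sup _ in supT.
  have sP l : 1 < rnorm l -> ((d l)%:E * opnorm (resolvent T l) <= s)%E.
    by move=> l1; apply: ereal_sup_ubound; exists l.
  exists (Num.max 1 (fine s)); first by rewrite lt_max ltr01.
  move=> l l1; apply: le_trans (sP l l1) _.
  move: supT; case: (s) => [r| |] //= _; last by rewrite leNye.
  by rewrite lee_fin le_max lexx orbT.
exists M^-1; first by rewrite invr_gt0.
move=> l x l1; have inv : invertible_op (GRing.scale l \- T : {linear X -> X}).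
  by apply: contrapT => /specT /=; rewrite leNgt l1.
have [->|dl] := eqVneq (d l) 0; first by rewrite mulr0 mul0r rnorm_ge0.
have dl0 : 0 < d l by rewrite lt_neqAle eq_sym dl d0.
rewrite -mulrA ler_pdivrMl // -ler_pdivlMl // mulrA [_^-1 * M]mulrC.
apply: (iffLR (opnorm_opinv_leP inv _)); first by rewrite divr_ge0 // ltW.
have := MP l l1; rewrite -/(resolvent T l) => Ml.
by rewrite EFinM muleC lee_pdivlMl.
Qed.

End OperatorNorm.

(** * The equivalences and the quantitative bound *)

Section Equivalences.
Context {R : realType} {X : completeNormedModType R[i]}.
Implicit Types (T S : {linear X -> X}) (l : R[i]) (E : set R[i]).

Lemma dist1_lipschitz (l w : R[i]) :
  rnorm (l - 1) <= rnorm (w - 1) + rnorm (l - w).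
Proof. by rewrite [leRHS]addrC -(subrKA w l (- 1)) ler_rnormD. Qed.

Lemma Ritt_iter_of_unity_below T N : contraction T -> (0 < N)%N ->
  unity_below T N -> is_Ritt (iter N T).
Proof.
move=> Tc N0 /(power_below_of_unity N0)[c c0 cP].
have Sc := contraction_iter N Tc.
apply: (@weighted_Ritt_of_below _ _ _ _ (c / (c + 2)) Sc).
- by rewrite divr_gt0 // addr_gt0.
- by move=> l; apply: rnorm_ge0.
move=> l x /ltW l1; apply: (exterior_of_circle Sc c0 dist1_lipschitz) => //.
Qed.

Lemma Ritt_on_of_unity_below T N : contraction T -> odd N -> unity_below T N ->
  exists E, [/\ finite_set E, E !=set0, E `<=` unit_circle,
    (forall z, E z -> exists m : nat, odd m /\ m.-primitive_root z) &
    is_Ritt_on E T].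
Proof.
move=> Tc oN [c c0 cP]; have N0 := odd_gt0 oN.
set E := [set z : R[i] | z ^+ N = 1].
have E0 : E !=set0 by exists 1; rewrite /E /= expr1n.
exists E; split => //; first exact: finite_unity_roots.
- by move=> z zN; apply: (rnorm_expr_eq1 N0); rewrite zN rnorm1.
- move=> z /(prim_order_exists N0)[m mP mN]; exists m; split => //.
  exact: dvdn_odd mN oN.
apply: (@weighted_Ritt_of_below _ _ _ _ (c / (c + 2)) Tc).
- by rewrite divr_gt0 // addr_gt0.
- by move=> l; apply: dist_to_ge0.
move=> l x /ltW l1.
apply: (exterior_of_circle Tc c0 (fun l w => dist_to_lipschitz l w E0)) => //.
move=> w y w1; apply: le_trans (cP w y w1).
by rewrite ler_wpM2r ?rnorm_ge0 // ler_wpM2l ?dist_to_unity_roots // ltW.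
Qed.

Lemma unity_below_of_Ritt_on T E : contraction T -> finite_set E ->
  E !=set0 -> E `<=` unit_circle ->
  (forall z, E z -> exists m : nat, odd m /\ m.-primitive_root z) ->
  is_Ritt_on E T -> exists N, odd N /\ unity_below T N.
Proof.
move=> Tc Efin E0 E1 Eprim TE.
have [N [oN NP]] := exists_common_odd_order Efin Eprim.
have N0 : 0 < N%:R :> R by rewrite ltr0n odd_gt0.
exists N; split => //.
have [|c c0 cP] := below_of_weighted_Ritt _ TE.
  by move=> l; apply: dist_to_ge0.
exists (c / N%:R); first by rewrite divr_gt0.
move=> l x l1; apply: le_trans (circle_of_exterior Tc c0
  (fun l w => dist_to_lipschitz l w E0) cP x l1).
rewrite ler_wpM2r ?rnorm_ge0 // -mulrA ler_wpM2l ?(ltW c0) //.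
rewrite ler_pdivrMl //; apply: rnorm_expr_sub1_dist_to => // z Ez.
by split; [exact: E1 | exact: NP].
Qed.

Lemma I_add_pow_below_of_sup T : (sup_I_sub_pow T < 2%:E)%E ->
  exists2 e : R, 0 < e &
    forall n x, (0 < n)%N -> e * rnorm x <= rnorm (x + iter n T x).
Proof.
set s := sup_I_sub_pow T => s2.
have sP n : (0 < n)%N -> (opnorm (fun x : X => (x - iter n T x)%R) <= s)%E.
  by move=> n0; apply: ereal_sup_ubound; exists n.
have s0 : (0 <= s)%E by apply: le_trans (sP 1%N isT); apply: opnorm_ge0.
have sE : s = (fine s)%:E by rewrite fineK // ge0_fin_numE // (lt_trans s2) // ltry.
exists (2 - fine s); first by rewrite subr_gt0 -lte_fin -sE.
move=> n x n0; have := sP n n0; rewrite sE.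
move/(opnorm_leP (idfun \- iter n T : {linear X -> X}) (fine_ge0 s0)).
move=> /(_ x) /= le_s.
have -> : x + iter n T x = 2%:R *: x - (x - iter n T x).
  by rewrite opprB addrA scaler_nat mulr2n addrAC addrK.
apply: le_trans (lerB_rnorm _ _); rewrite rnormZ rnorm_nat mulrBl.
by rewrite lerD2l lerN2.
Qed.

Lemma below_of_Ritt S : contraction S -> is_Ritt S ->
  exists2 c : R, 0 < c & forall l x, 1 <= rnorm l ->
    c * rnorm (l - 1) * rnorm x <= rnorm (l *: x - S x).
Proof.
move=> Sc /(below_of_weighted_Ritt (fun l => rnorm_ge0 (l - 1)))[c c0 cP].
exists c => // l x; rewrite le_eqVlt => /orP[/eqP/esym l1|l1]; last exact: cP.
exact: (circle_of_exterior Sc c0 dist1_lipschitz cP).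
Qed.

(** I + S^n is a small perturbation of the surjective operator (1 + t) + S^n.
    With t = 1 / (3 K) the latter is bounded below by 3 t - t, more than the
    size t of the perturbation. *)
Lemma surjective_I_add_pow S (K : R) n : contraction S -> 0 < K ->
  (forall x, rnorm x <= K * rnorm (x + iter n S x)) ->
  forall y, exists x, x + iter n S x = y.
Proof.
move=> Sc K0 KP; have Snc := contraction_iter n Sc.
pose t := (3 * K)^-1; have t0 : 0 < t by rewrite invr_gt0 mulr_gt0.
pose B : {linear X -> X} := GRing.scale (1 + t)%:C%C \+ iter n S.
have BE x : B x - (x + iter n S x) = t%:C%C *: x.
  rewrite /B /= opprD addrACA subrr addr0 -{2}[x]scale1r -scalerBl.
  by rewrite rmorphD rmorph1 addrC addKr.
apply: (@surjective_perturbation R X (idfun \+ iter n S : {linear X -> X}) B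
  t (t + t) 2) => //.
- exact: ltW.
- by rewrite ltrDl.
- move=> x /=; apply: le_trans (ler_rnormD _ _) _.
  by rewrite mulrDl mul1r lerD2l; apply: Snc.
- move=> y; have [|x xP] := surjective_exterior (l := - (1 + t)%:C%C) Snc _ (- y).
    by rewrite rnormN rnorm_real ger0_norm; lra.
  by exists x; rewrite /B /= -[y]opprK -xP scaleNr opprB opprK addrC.
- move=> x; have -> : B x = (x + iter n S x) + t%:C%C *: x.
    by rewrite -(BE x) subrKC.
  apply: le_trans (lerB_rnormD _ _); rewrite rnormZr ?(ltW t0) //.
  rewrite lerBrDr; have := KP x; rewrite -ler_pdivrMl //; apply: le_trans.
  have -> : K^-1 = t + t + t by rewrite /t; field; rewrite gt_eqF.
  by rewrite -mulrDl.
by move=> x; rewrite BE rnormZr // ltW.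
Qed.

Lemma convexity_modulus_le (e : R) (x y : X) : rnorm x <= 1 -> rnorm y <= 1 ->
  e <= rnorm (x - y) -> rnorm (x + y) <= 2 * (1 - convexity_modulus X e).
Proof.
move=> x1 y1 exy.
have half a : rnorm (2^-1 *: a : X) = rnorm a / 2.
  have -> : (2^-1 : R[i]) = (2^-1)%:C%C by rewrite fmorphV rmorph_nat.
  by rewrite rnormZr ?invr_ge0 // mulrC.
have : convexity_modulus X e <= 1 - rnorm (2^-1 *: (x + y)).
  apply: ge_inf; last by exists x, y.
  exists 0 => _ [a [b [a1 b1 _ ->]]]; rewrite half subr_ge0 ler_pdivrMr // mul1r.
  apply: le_trans (ler_rnormD _ _) _.
  by apply: le_trans (lerD a1 b1) _.
by rewrite half; lra.
Qed.

(** Uniform convexity applied to x and - T^n x. *)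
Lemma I_sub_pow_le T (K : R) n x : contraction T -> 0 < K ->
  (forall x, rnorm x <= K * rnorm (x + iter n T x)) -> rnorm x = 1 ->
  rnorm (x - iter n T x) <= 2 * (1 - convexity_modulus X (1 / K)).
Proof.
move=> Tc K0 KP x1; apply: convexity_modulus_le; rewrite ?x1 ?rnormN //.
  by rewrite -x1; apply: contraction_iter.
by rewrite opprK ler_pdivrMr // mulrC -x1.
Qed.

(** The bound [1 / 2 <= fine (Kplus T N)], which comes from |I + T^(nN)| <= 2,
    keeps the argument of the modulus of convexity within (0, 2]. *)
Theorem Ritt_iter_quantitative T N : (exists x : X, x != 0) -> contraction T ->
  odd N -> is_Ritt (iter N T) ->
  [/\ (forall n : nat, (1 <= n)%N ->
        invertible_op (fun x : X => x + iter (n * N) T x)),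
      (Kplus T N < +oo)%E,
      1 / 2 <= fine (Kplus T N) &
      (sup_I_sub_pow T <=
      (2 * (1 - convexity_modulus X (1 / (N%:R * fine (Kplus T N)))))%:E)%E].
Proof.
move=> [v v0] Tc oN NR; have Sc := contraction_iter N Tc.
have v0' := rnorm_gt0 v0.
have [c c0 cP] := below_of_Ritt Sc NR.
pose K := 2 + (4 * c ^+ 2)^-1.
have K0 : 0 < K by rewrite addr_gt0 // invr_gt0 mulr_gt0 // exprn_gt0.
have KP n x : (0 < n)%N -> rnorm x <= K * rnorm (x + iter (n * N) T x).
  by move=> n0; rewrite iterM; apply: (rnorm_I_add_pow_ge x Sc c0 cP n0).
have inv n : (0 < n)%N ->
    invertible_op (idfun \+ iter (n * N) T : {linear X -> X}).
  move=> n0; apply: (@invertible_of_below _ _ _ K); last by move=> x; apply: KP.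
  have := @surjective_I_add_pow (iter (n * N) T) K 1 (contraction_iter _ Tc) K0.
  by apply => x; apply: KP.
have KK : (Kplus T N <= K%:E)%E.
  apply: ge_ereal_sup => _ [n n0 <-].
  by apply/(opnorm_opinv_leP (inv n n0) (ltW K0)) => x; apply: KP.
have kub n : (0 < n)%N ->
    (opnorm (opinv (fun x : X => (x + iter (n * N) T x)%R)) <= Kplus T N)%E.
  by move=> n0; apply: ereal_sup_ubound; exists n.
have Kfin : (Kplus T N < +oo)%E := le_lt_trans KK (ltry K).
have k0 : (0 <= Kplus T N)%E by apply: le_trans (kub 1%N isT); apply: opnorm_ge0.
have kE : Kplus T N = (fine (Kplus T N))%:E by rewrite fineK // ge0_fin_numE.
set k := fine (Kplus T N) in kE *.
have kP n x : (0 < n)%N -> rnorm x <= k * rnorm (x + iter (n * N) T x).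
  move=> n0; apply: (iffLR (opnorm_opinv_leP (inv n n0) (fine_ge0 k0))).
  by rewrite -/k -kE; apply: kub.
have k12 : 1 / 2 <= k.
  rewrite -(ler_pM2r v0'); have := kP 1%N v isT.
  have : rnorm (v + iter (1 * N) T v) <= 2 * rnorm v.
    apply: le_trans (ler_rnormD _ _) _.
    by rewrite mulrDl mul1r lerD2l; apply: contraction_iter.
  move=> /(ler_wpM2l (fine_ge0 k0)); rewrite -/k; lra.
split; [exact: inv | exact: Kfin | exact: k12 | ].
have Nk0 : 0 < N%:R * k by rewrite mulr_gt0 ?ltr0n ?odd_gt0 //; lra.
have NkP n x : (0 < n)%N -> rnorm x <= N%:R * k * rnorm (x + iter n T x).
  move=> n0; apply: le_trans (kP n x n0) _.
  (* N is odd, so I + T^(nN) = - ((-1)^N - (T^n)^N) is divisible by I + T^n *)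
  rewrite [N%:R * k]mulrC -mulrA ler_wpM2l ?(fine_ge0 k0) // mulnC iterM.
  have := @rnorm_pow_sub R X (iter n T) (-1) N x (contraction_iter n Tc).
  rewrite rnormN rnorm1 -signr_odd oN expr1 !scaleN1r -!opprD !rnormN.
  exact.
apply: ge_ereal_sup => _ [n /= n0 <-]; set D := 2 * _.
have Dunit x : rnorm x = 1 -> rnorm (x - iter n T x) <= D.
  by apply: I_sub_pow_le => // y; apply: NkP.
have unit (x : X) : x != 0 -> rnorm ((rnorm x)^-1%:C%C *: x) = 1.
  by move=> /rnorm_gt0 x0; rewrite rnormZr ?invr_ge0 ?mulVf ?gt_eqF ?ltW.
have D0 : 0 <= D by apply: le_trans (Dunit _ (unit v v0)); apply: rnorm_ge0.
apply/(opnorm_leP (idfun \- iter n T : {linear X -> X}) D0) => x /=.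
have [->|x0] := eqVneq x 0; first by rewrite linear0 subrr !rnorm0 mulr0.
have := Dunit _ (unit x x0).
have nx := rnorm_gt0 x0; rewrite linearZ -scalerBr rnormZr ?invr_ge0 ?(ltW nx) //.
by rewrite ler_pdivrMl // mulrC.
Qed.

End Equivalences.

Theorem theoremB (R : realType) (X : completeNormedModType R[i])
    (X_nontrivial : exists x : X, x != 0) (X_uc : uniformly_convex X)
    (T : X -> X) (T_bounded : bounded_operator T)
    (T_contraction : (opnorm T <= 1%:E)%E) :
  ((sup_I_sub_pow T < 2%:E)%E <-> (exists N : nat, odd N /\ is_Ritt (iter N T)))
  /\
  ((exists N : nat, odd N /\ is_Ritt (iter N T)) <->
   (exists E : set R[i],
      [/\ finite_set E, E !=set0, E `<=` unit_circle,
          (forall z, E z -> exists m : nat, odd m /\ m.-primitive_root z) &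
          is_Ritt_on E T]))
  /\
  (forall N : nat, odd N -> is_Ritt (iter N T) ->
     [/\ (forall n : nat, (1 <= n)%N ->
            invertible_op (fun x : X => x + iter (n * N) T x)),
         (Kplus T N < +oo)%E &
         (sup_I_sub_pow T <=
          (2 * (1 - convexity_modulus X (1 / (N%:R * fine (Kplus T N)))))%:E)%E]).
Proof.
case: T_bounded => /linear_pack[A AE] _; move: T_contraction; rewrite {T}AE.
move=> /(opnorm_leP _ ler01) Ac.
have {}Ac : contraction A by move=> x; rewrite -[leRHS]mul1r.
have quant N := @Ritt_iter_quantitative R X A N X_nontrivial Ac.
have i_of_ii N : odd N -> is_Ritt (iter N A) -> (sup_I_sub_pow A < 2%:E)%E.
  move=> oN /(quant N oN)[_ _ k12 le_sup]; apply: le_lt_trans le_sup _.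
  set e := 1 / _; have N1 : 1 <= N%:R :> R by rewrite ler1n odd_gt0.
  have Nk : 1 / 2 <= N%:R * fine (Kplus A N) by nra.
  have e0 : 0 < e by rewrite divr_gt0 //; lra.
  have e2 : e <= 2 by rewrite ler_pdivrMr; lra.
  by rewrite lte_fin; have := X_uc e e0 e2; lra.
have unity_of_i :
    (sup_I_sub_pow A < 2%:E)%E -> exists N, odd N /\ unity_below A N.
  by move=> /I_add_pow_below_of_sup[e e0 eP]; apply: odd_unity_below eP.
have ii_of_i : (sup_I_sub_pow A < 2%:E)%E -> exists N, odd N /\ is_Ritt (iter N A).
  move=> /unity_of_i[N [oN NP]]; exists N; split => //.
  by apply: Ritt_iter_of_unity_below; rewrite ?odd_gt0.
split; [|split].
- by split => // -[N [oN NR]]; apply: i_of_ii NR.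
- split=> [[N [oN /(i_of_ii N oN)/unity_of_i[M [oM MP]]]]|[E [Ef E0 E1 Ep ER]]].
    exact: Ritt_on_of_unity_below MP.
  have [N [oN NP]] := unity_below_of_Ritt_on Ac Ef E0 E1 Ep ER.
  by exists N; split => //; apply: Ritt_iter_of_unity_below; rewrite ?odd_gt0.
by move=> N oN NR; have [? ? _ ?] := quant N oN NR; split.
Qed.
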